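(* Let $n>1$, let $S=\{o_1,\dots,o_n\}$ be a finite set of OIE instances, where $o_i$ is mapped to an event $e_i$ which corresponds bijectively to an operand $p_i$ (the operand symbols $p_1,\dots,p_n$ being distinct), let $\odot$ be an $n$-ary finitary operator, and let $*\in\{\oplus|_\alpha^\beta,\otimes\}$ (with $\alpha<\beta$ real). Let $\mathcal O(S,* )$ be the orbit space. For every equivalence class $K\in\mathcal O(S,* )$ of non-void results there exists a unique set $\mathrm{Op}_K$ of $n$-ary operation expressions such that for each result $r$ of $*$ on $S$ belonging to $K$, the projection based on ending timestamps applied to $r$ yields exactly $\mathrm{Op}_K$. Moreover: (1) For $*=\oplus|_\alpha^\beta$: the orbit space $\mathcal O(S,\oplus|_\alpha^\beta)$ consists of a single equivalence class, so (when the results are non-void) the whole orbit is associated with a unique set $\mathrm{Op}$. If $\odot$ satisfies permutational equivalence (its result is invariant under any reordering of its operands), then all expressions in $\mathrm{Op}$ denote the same operation (take the same value). If $\odot$ does not satisfy permutational equivalence, the expressions in $\mathrm{Op}$ may denote distinct operations (i.e. there exist instances of this setting in which two expressions of $\mathrm{Op}$ take different values). (2) For $*=\otimes$: the orbit space $\mathcal O(S,\otimes)$ may contain several equivalence classes (i.e. there exist $S$ for which it has more than one element). For each equivalence class $K\in\mathcal O(S,\otimes)$ of non-void results, $\mathrm{Op}_K$ contains exactly one expression, and this expression is uniquely determined by the order of operands specified by any index tuple producing a representative of $K$: if $(i_1,\dots,i_n)$ is an index tuple with $\otimes(o_{i_1},\dots,o_{i_n})\in K$, the expression is $\odot(p_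{i_1},\dots,p_{i_n})$.
   Context: Times are real numbers; a ''2-tuple'' is a pair $(x,y)$ of reals with $x<y$ (starting and ending timestamp). For a nonempty finite tuple of 2-tuples $T=((x_1,y_1),\dots,(x_m,y_m))$ put $\mathrm{bound}(T)=(\min_i x_i,\max_i y_i)$. An OIE (Optional Intervals Event) instance is a 4-tuple $o=(\mathcal C_o,\mathcal F_o,\mathcal I_o,\mathcal A_o)$ where $\mathcal C_o$ is a finite (possibly empty) tuple of OIE instances, $\mathcal F_o$ is a set of nonempty finite tuples of 2-tuples, $\mathcal I_o=\{\mathrm{bound}(T):T\in\mathcal F_o\}$, and $\mathcal A_o$ is a set of (labels of) atomic events. The void instance is $o_{\mathrm{void}}=((),\emptyset,\emptyset,\emptyset)$; every other instance has $\mathcal F_o,\mathcal I_o,\mathcal A_o$ nonempty. Two instances are equal iff all four components are equal. An index tuple of length $n$ is a tuple in which each of $1,\dots,n$ occurs exactly once. A permutation matrix $M$ acts on $n$-tuples (viewed as row vectors) on the right by reordering the entries, $T\mapsto T\cdot M$. For $S=\{o_1,\dots,o_n\}$ and an index tuple $\sigma=(i_1,\dots,i_n)$, let $N(S,\sigma)=\{(t_1,\dots,t_n): t_k\in\mathcal I_{o_{i_k}}\text{ for all }k\}$. External constraints determine an infeasible subset $\mathrm{Inf}(S,\sigma)\subseteq N(S,\sigma)$; this is given data, subject only to the standing axiom: whenever $\sigma\cdot M=\tau$ for index tuples $\sigma,\tau$ of length $n>1$ and a permutation matrix $M$, the map $T\mapsto T\cdot M$ is a bijection from $\mathrm{Inf}(S,\sigma)$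 onto $\mathrm{Inf}(S,\tau)$. Put $\mathrm{Feas}(S,\sigma)=N(S,\sigma)\setminus\mathrm{Inf}(S,\sigma)$. In the existence (''may'') assertions, the infeasibility data (subject to the axiom) is part of the instance to be exhibited. Domain filter: for a nonempty set $X$ of $n$-tuples of 2-tuples and reals $\alpha<\beta$, let $X'=\{T\in X: x\ge\alpha\text{ and }y\le\beta\text{ for every entry }(x,y)\text{ of }T\}$. Then $\mathrm{Dom}_\alpha^\beta(X)=X'$ if for every $k\in\{1,\dots,n\}$ some $T\in X'$ has $k$-th entry with first item $\alpha$ and some $T\in X'$ has $k$-th entry with second item $\beta$; otherwise $\mathrm{Dom}_\alpha^\beta(X)=\emptyset$. Ascending filter: for a set $X$ of tuples of 2-tuples, $\mathrm{Asc}(X)$ is the set of $T\in X$ such that for all positions $p<q$ the second item of the $p$-th entry of $T$ is $\le$ the first item of the $q$-th entry of $T$. Complete Sequence Addition $\oplus|_\alpha^\beta(o_{i_1},\dots,o_{i_n})$ and Complete Sequence Multiplication $\otimes(o_{i_1},\dots,o_{i_n})$, with $\sigma=(i_1,\dots,i_n)$: write $\Phi=\mathrm{Dom}_\alpha^\beta$ for $\oplus|_\alpha^\beta$ and $\Phi=\mathrm{Asc}$ for $\otimes$. The result is $o_{\mathrm{void}}$ if $\bigcap_{k}\mathcal A_{o_{i_k}}\ne\emptyset$, or some $o_{i_k}=o_{\mathrm{void}}$, or $\mathrm{Feas}(S,\sigma)=\emptyset$, or $\Phi(\mathrm{Feas}(S,\sigma))=\emptyset$. Otherwise the result is $(\mathcal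 C,\mathcal F,\mathcal I,\mathcal A)$ with $\mathcal C=(o_{i_1},\dots,o_{i_n})$, $\mathcal F=\Phi(\mathrm{Feas}(S,\sigma))$, $\mathcal I=\{\mathrm{bound}(T):T\in\mathcal F\}$, $\mathcal A=\bigcup_k\mathcal A_{o_{i_k}}$. Permutational equivalence $\sim$: two non-void instances $o,o'$ satisfy $o\sim o'$ if there is a permutation matrix $M$ such that $\mathcal C_o\cdot M=\mathcal C_{o'}$, $T\mapsto T\cdot M$ is a bijection from $\mathcal F_o$ onto $\mathcal F_{o'}$, $\mathcal I_o=\mathcal I_{o'}$ and $\mathcal A_o=\mathcal A_{o'}$. By convention $o_{\mathrm{void}}\sim o_{\mathrm{void}}$, and $o_{\mathrm{void}}$ is equivalent to no non-void instance. The orbit space $\mathcal O(S,* )$ is the set of $\sim$-equivalence classes of the results $*(o_{i_1},\dots,o_{i_n})$ over all index tuples $(i_1,\dots,i_n)$ of length $n$. Projection based on ending timestamps. Let $r=*(o_{i_1},\dots,o_{i_n})$ be non-void. For $T=((x_1,y_1),\dots,(x_n,y_n))\in\mathcal F_r$, the $k$-th entry is attached to the operand $p_{i_k}$. Let $t_1<\dots<t_\lambda$ be the distinct values among $y_1,\dots,y_n$ and let $G_\theta=\{p_{i_k}: y_k=t_\theta\}$. The expressions generated by $T$ are all formal expressions $\odot(q_1,\dots,q_n)$ in which $(q_1,\dots,q_n)$ is a concatenation of an arbitrary ordering of $G_1$, then an arbitrary ordering of $G_2$, ..., then an arbitrary ordering of $G_\lambda$. The projection yields the union over all $T\in\mathcal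 F_r$ of the sets of expressions generated by $T$; two formal expressions are identified only if they have the same sequence of operands. The projection is undefined for a void result. The value of an expression is obtained by interpreting the operands as elements of a set $X$ and $\odot$ as a map $X^n\to X$. *)

(* Defs.v *)
From mathcomp Require Export all_boot all_order all_algebra perm.
From mathcomp Require Export boolp classical_sets functions reals.

Set Implicit Arguments.
Unset Strict Implicit.
Unset Printing Implicit Defensive.

Import Order.TTheory GRing.Theory Num.Theory.

Local Open Scope classical_set_scope.
Local Open Scope ring_scope.

(* A permutation matrix of size n is represented by s : 'S_n, standing for
   perm_mx s; the row vector (t_0, ..., t_(n-1)) times perm_mx s has entry
   t_(s^-1 j) in position j. *)
Definition permute (n : nat) (T : Type) (s : 'S_n) (t : n.-tuple T) :
    n.-tuple T :=
  [tuple tnth t ((s^-1)%g j) | j < n].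

(* Indices are 0-based. *)
Definition index_tuple (n : nat) (sigma : n.-tuple 'I_n) : Prop :=
  forall i : 'I_n, count_mem i sigma = 1%N.

(* A 2-tuple is an element of R * R; the condition starting < ending is part of
   is_oie.  L is the type of labels of atomic events. *)
Inductive oie (R : realType) (L : Type) : Type :=
  OIE : seq (oie R L) -> set (seq (R * R)) -> set (R * R) -> set L -> oie R L.

Arguments OIE {R L} _ _ _ _.

Section Instances.
Variables (R : realType) (L : Type).

Definition components (o : oie R L) : seq (oie R L) :=
  let: OIE C _ _ _ := o in C.
Definition formations (o : oie R L) : set (seq (R * R)) :=
  let: OIE _ F _ _ := o in F.
Definition intervals (o : oie R L) : set (R * R) :=
  let: OIE _ _ J _ := o in J.
Definition atoms (o : oie R L) : set L :=
  let: OIE _ _ _ A := o in A.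

Definition oie_void : oie R L := OIE [::] set0 set0 set0.

(* The value on the empty sequence is junk. *)
Definition bound (T : seq (R * R)) : R * R :=
  if T is t :: T' then
    (\big[Num.min/t.1]_(u <- T') u.1, \big[Num.max/t.2]_(u <- T') u.2)
  else (0, 0).

(* The raw type oie only fixes the shape of the four components; is_oie singles
   out the actual instances.  Nonemptiness of the third component follows from
   that of F. *)
Inductive is_oie : oie R L -> Prop :=
| is_oie_void : is_oie oie_void
| is_oie_event C (F : set (seq (R * R))) (A : set L) :
    (forall k, (k < size C)%N -> is_oie (nth oie_void C k)) ->
    (forall T, F T -> T <> [::] /\ {in T, forall t, t.1 < t.2}) ->
    F !=set0 -> A !=set0 ->
    is_oie (OIE C F (bound @` F) A).

(* c, c' and X, X' are the components and the formations of o and o', all of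
   whose tuples must have the size m of the permutation matrix. *)
Definition perm_equiv (o o' : oie R L) : Prop :=
  (o = oie_void /\ o' = oie_void) \/
  (o <> oie_void /\ o' <> oie_void /\
   exists (m : nat) (s : 'S_m) (c c' : m.-tuple (oie R L))
          (X X' : set (m.-tuple (R * R))),
     (components o = c /\ components o' = c') /\
     (formations o = [set tval T | T in X] /\
      formations o' = [set tval T | T in X']) /\
     permute s c = c' /\
     set_bij X X' (permute s) /\
     intervals o = intervals o' /\
     atoms o = atoms o').

Definition assignments (n : nat) (inst : 'I_n -> oie R L)
    (sigma : n.-tuple 'I_n) : set (n.-tuple (R * R)) :=
  [set T | forall k, intervals (inst (tnth sigma k)) (tnth T k)].

End Instances.

(* A set S of n instances, its external constraints, and the operand attached
   to each element.  Only the values of infeas on index tuples matter. *)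
Record setting (R : realType) (n : nat) := Setting {
  label : Type;
  inst : 'I_n -> oie R label;
  inst_oie : forall i, is_oie (inst i);
  inst_inj : injective inst;
  infeas : n.-tuple 'I_n -> set (n.-tuple (R * R));
  infeas_sub : forall sigma, index_tuple sigma ->
    infeas sigma `<=` assignments inst sigma;
  infeas_permute : forall (sigma tau : n.-tuple 'I_n) (s : 'S_n),
    index_tuple sigma -> index_tuple tau -> permute s sigma = tau ->
    set_bij (infeas sigma) (infeas tau) (permute s);
  event : Type;
  event_of : 'I_n -> event;
  operand : eqType;
  operand_of : event -> operand;
  operand_inj : injective (fun i => operand_of (event_of i))
}.

(* CSA a b is Complete Sequence Addition on the domain (a, b), and CSM is
   Complete Sequence Multiplication. *)
Variant complete_op (R : realType) := CSA of R & R | CSM.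
Arguments CSM {R}.

Section Filters.
Variables (R : realType) (n : nat).
Implicit Type X : set (n.-tuple (R * R)).

Definition within_domain (a b : R) X : set (n.-tuple (R * R)) :=
  [set T | X T /\ forall k, a <= (tnth T k).1 /\ (tnth T k).2 <= b].

Definition dom_filter (a b : R) X : set (n.-tuple (R * R)) :=
  if `[< forall k : 'I_n,
           (exists2 T, within_domain a b X T & (tnth T k).1 = a) /\
           (exists2 T, within_domain a b X T & (tnth T k).2 = b) >]
  then within_domain a b X else set0.

Definition asc_filter X : set (n.-tuple (R * R)) :=
  [set T | X T /\
     forall p q : 'I_n, (p < q)%N -> (tnth T p).2 <= (tnth T q).1].

Definition op_filter (op : complete_op R) :
    set (n.-tuple (R * R)) -> set (n.-tuple (R * R)) :=
  match op with CSA a b => dom_filter a b | CSM => asc_filter end.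

End Filters.

(* A formal expression: the operator symbol applied to n operands. *)
Variant op_expr (n : nat) (P : Type) := OpExpr of n.-tuple P.

Definition operands (n : nat) (P : Type) (e : op_expr n P) : n.-tuple P :=
  let: OpExpr q := e in q.

Definition value (n : nat) (P X : Type) (odot : n.-tuple X -> X) (v : P -> X)
    (e : op_expr n P) : X :=
  odot (map_tuple v (operands e)).

Definition perm_invariant (n : nat) (X : Type) (odot : n.-tuple X -> X) : Prop :=
  forall (s : 'S_n) (x : n.-tuple X), odot (permute s x) = odot x.

Section Results.
Variables (R : realType) (n : nat) (S : setting R n).
Implicit Types (op : complete_op R) (sigma : n.-tuple 'I_n).

Definition feas sigma : set (n.-tuple (R * R)) :=
  assignments (@inst R n S) sigma `\` infeas S sigma.

Definition result op sigma : oie R (label S) :=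
  if `[< (\bigcap_k atoms (inst S (tnth sigma k))) !=set0 \/
         (exists k, inst S (tnth sigma k) = oie_void R (label S)) \/
         feas sigma = set0 \/
         op_filter op (feas sigma) = set0 >]
  then oie_void R (label S)
  else
    let F := [set tval T | T in op_filter op (feas sigma)] in
    OIE [seq inst S i | i <- sigma] F (@bound R @` F)
        (\bigcup_k atoms (inst S (tnth sigma k))).

Definition results op : set (oie R (label S)) :=
  [set r | exists2 sigma, index_tuple sigma & r = result op sigma].

Definition orbit_space op : set (set (oie R (label S))) :=
  [set K | exists2 r, results op r &
           K = [set r' | results op r' /\ perm_equiv r r']].

Definition opd (i : 'I_n) : operand S := operand_of (event_of S i).

Definition expr_of sigma : op_expr n (operand S) :=
  OpExpr (map_tuple opd sigma).

Definition end_times (T : n.-tuple (R * R)) : seq R :=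
  sort <=%R (undup [seq t.2 | t <- T]).

Definition end_group sigma (T : n.-tuple (R * R)) (t : R) : set (operand S) :=
  [set opd (tnth sigma k) | k in [set k | (tnth T k).2 = t]].

Definition ordering_of (G : set (operand S)) (b : seq (operand S)) : Prop :=
  uniq b /\ [set` b] = G.

Definition generated sigma (T : n.-tuple (R * R)) :
    set (op_expr n (operand S)) :=
  [set e | exists bs : seq (seq (operand S)),
     [/\ size bs = size (end_times T),
         forall theta, (theta < size (end_times T))%N ->
           ordering_of (end_group sigma T (nth 0 (end_times T) theta))
                       (nth [::] bs theta)
       & tval (operands e) = flatten bs]].

(* Only meaningful when result op sigma is not void. *)
Definition projection op sigma : set (op_expr n (operand S)) :=
  [set e | exists2 T : n.-tuple (R * R),
     formations (result op sigma) (tval T) & generated sigma T e].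

Definition is_Op op (K : set (oie R (label S)))
    (Op : set (op_expr n (operand S))) : Prop :=
  forall sigma, index_tuple sigma -> K (result op sigma) ->
    projection op sigma = Op.

Definition nonvoid_class op (K : set (oie R (label S))) : Prop :=
  orbit_space op K /\ forall r, K r -> r <> oie_void R (label S).

End Results.

Arguments is_Op {R n} S op K Op.
Arguments nonvoid_class {R n} S op K.
Arguments feas {R n} S sigma _.
Arguments result {R n} S op sigma.
Arguments results {R n} S op _.
Arguments orbit_space {R n} S op _.
Arguments projection {R n} S op sigma _.
Arguments expr_of {R n} S sigma.

(* Main.v *)
Require Import Defs.

Import Order.TTheory GRing.Theory Num.Theory.
Local Open Scope classical_set_scope.
Local Open Scope ring_scope.

(** Relabelling the positions of an index tuple sigma by a permutation s, and
    the positions of a formation T by the same s, leaves the set of pairs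
    (operand, interval) unchanged.  The expressions generated by T depend on
    these pairs only ([generated_permute]), while permutational equivalence of
    two non-void results says precisely that their formations correspond under
    such a relabelling: since distinct indices carry distinct instances, the
    permutation that matches the components also carries one index tuple to the
    other.  Equivalent non-void results therefore have the same projection
    ([perm_equiv_projection]), and Op_K is the projection of any
    representative.

    Addition.  Any two index tuples differ by a permutation.  Feasibility is
    compatible with it by the axiom on external constraints, and the domain
    filter does not look at the order of positions, so all results are
    equivalent ([perm_equiv_addition]).  An expression generated by a formation
    lists every operand once ([generated_perm_eq]), which makes the values agree
    when the operator ignores the order of its operands.

    Multiplication.  An ascending formation ends its intervals one strictly
    after the other, so that the projection leaves no freedom and returns the
    order of the index tuple ([projection_multiplication]).

    Both existence claims use settings in which each instance has one interval
    and nothing is infeasible.  If all intervals are (alpha, beta), every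
    ordering of the operands is generated, and an operator that is not
    permutation invariant separates two of them.  If the i-th interval is
    (i, i + 1), the identity has a non-void product, while exchanging the first
    two instances gives the void one. *)

(** * Permuting tuples *)

Lemma tnth_permute {n : nat} {T : Type} (s : 'S_n) (t : n.-tuple T) k :
  tnth (permute s t) (s k) = tnth t k.
Proof. by rewrite tnth_mktuple permK. Qed.

Lemma tnth_permuteV {n : nat} {T : Type} (s : 'S_n) (t : n.-tuple T) k :
  tnth (permute s t) k = tnth t ((s^-1)%g k).
Proof. exact: tnth_mktuple. Qed.

Lemma permuteK {n : nat} {T : Type} (s : 'S_n) :
  cancel (@permute n T s) (permute (s^-1)%g).
Proof. by move=> t; apply: eq_from_tnth => k; rewrite !tnth_mktuple invgK permK. Qed.

Lemma permuteKV {n : nat} {T : Type} (s : 'S_n) :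
  cancel (@permute n T (s^-1)%g) (permute s).
Proof. by move=> t; have := permuteK (s^-1)%g t; rewrite invgK. Qed.

Lemma permute_map {n : nat} {T U : Type} (f : T -> U) (s : 'S_n)
    (t : n.-tuple T) :
  permute s (map_tuple f t) = map_tuple f (permute s t).
Proof. by apply: eq_from_tnth => k; rewrite !(tnth_map, tnth_mktuple). Qed.

Lemma perm_eq_permute {n : nat} {T : eqType} (s : 'S_n) (t : n.-tuple T) :
  perm_eq (permute s t) t.
Proof. by apply/tuple_permP; exists (s^-1)%g. Qed.

(** Tuples with the same entries, even repeated ones, are related by an actual
    permutation matrix; this is how equalities up to order re-enter the theory
    of [permute]. *)
Lemma perm_eq_permuteP {n : nat} {T : eqType} (t u : n.-tuple T) :
  perm_eq t u -> exists s : 'S_n, permute s t = u.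
Proof.
rewrite perm_sym => /tuple_permP[p Eu]; exists (p^-1)%g.
by apply: val_inj; rewrite /= Eu /permute invgK.
Qed.

Lemma index_tuple_perm_enum {n : nat} (sigma : n.-tuple 'I_n) :
  index_tuple sigma <-> perm_eq sigma (enum 'I_n).
Proof.
have count1 i : count_mem i (enum 'I_n) = 1%N.
  by rewrite count_uniq_mem ?enum_uniq // mem_enum.
split=> [Hsigma|/seq.permP eq_c i]; last by rewrite eq_c count1.
by apply/allP=> i _; apply/eqP; rewrite /= Hsigma count1.
Qed.

Lemma index_tuple_ord_tuple (n : nat) : index_tuple (ord_tuple n).
Proof. by apply/index_tuple_perm_enum; rewrite val_ord_tuple. Qed.

Lemma index_tuple_permute {n : nat} (s : 'S_n) (sigma : n.-tuple 'I_n) :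
  index_tuple sigma -> index_tuple (permute s sigma).
Proof.
move=> /index_tuple_perm_enum Hsigma; apply/index_tuple_perm_enum.
exact: perm_trans (perm_eq_permute s sigma) Hsigma.
Qed.

Lemma index_tuples_permute {n : nat} (sigma tau : n.-tuple 'I_n) :
  index_tuple sigma -> index_tuple tau -> exists s, permute s sigma = tau.
Proof.
move=> /index_tuple_perm_enum Hsigma /index_tuple_perm_enum Htau.
by apply: perm_eq_permuteP; rewrite (perm_trans Hsigma) // perm_sym.
Qed.

Lemma index_tuple_uniq {n : nat} (sigma : n.-tuple 'I_n) :
  index_tuple sigma -> uniq sigma.
Proof. by move=> /index_tuple_perm_enum/perm_uniq->; apply: enum_uniq. Qed.

(** * Bounds *)

Section Bound.
Variable R : realType.
Implicit Types (T U : seq (R * R)) (c : R).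

(** The universal property of the minimum, in which the first entry no longer
    plays the special part that it has in [bound]. *)
Lemma le_bound1 T c :
  T != [::] -> (c <= (bound T).1) = all (fun t => c <= t.1) T.
Proof.
case: T => // t T _ /=; elim: T => [|u T IH]; first by rewrite big_nil andbT.
by rewrite big_cons le_min IH /= andbCA.
Qed.

Lemma bound2_le T c :
  T != [::] -> ((bound T).2 <= c) = all (fun t => t.2 <= c) T.
Proof.
case: T => // t T _ /=; elim: T => [|u T IH]; first by rewrite big_nil andbT.
by rewrite big_cons ge_max IH /= andbCA.
Qed.

Lemma perm_bound T U : perm_eq T U -> bound T = bound U.
Proof.
have [->|T0] := eqVneq T [::]; first by rewrite perm_sym => /perm_nilP->.
move=> TU; have U0 : U != [::].
  by apply: contra_neq T0 => U0; apply/perm_nilP; rewrite -U0.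
have half (V W : seq (R * R)) : V != [::] -> W != [::] -> perm_eq V W ->
    (bound V).1 <= (bound W).1 /\ (bound V).2 <= (bound W).2.
  move=> V0 W0 VW; split.
    by rewrite (le_bound1 W _ W0) -(perm_all _ VW) -(le_bound1 V _ V0).
  by rewrite (bound2_le V _ V0) (perm_all _ VW) -(bound2_le W _ W0).
have [TU1 TU2] := half T U T0 U0 TU.
have [UT1 UT2] : (bound U).1 <= (bound T).1 /\ (bound U).2 <= (bound T).2.
  by apply: (half U T) => //; rewrite perm_sym.
rewrite [bound T]surjective_pairing [bound U]surjective_pairing.
by congr pair; apply/le_anti/andP.
Qed.

Lemma bound_lt T :
  T <> [::] -> {in T, forall t, t.1 < t.2} -> (bound T).1 < (bound T).2.
Proof.
move=> /eqP T0 ltT; have [t tT] : exists t, t \in T.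
  by case: T T0 {ltT} => // t T _; exists t; rewrite mem_head.
have /allP/(_ t tT) le1 := etrans (esym (le_bound1 T _ T0)) (lexx (bound T).1).
have /allP/(_ t tT) le2 := etrans (esym (bound2_le T _ T0)) (lexx (bound T).2).
exact: le_lt_trans le1 (lt_le_trans (ltT t tT) le2).
Qed.

Lemma is_oie_lt {L : Type} (o : oie R L) t :
  is_oie o -> intervals o t -> t.1 < t.2.
Proof.
by case=> [|C F A _ ltF _ _] //= [T /ltF[T0 ltT] <-]; apply: bound_lt.
Qed.

End Bound.

(** * Tuple sets that differ by a permutation of positions *)

(** Equivalent to [permute s] being a bijection from X onto Y ([permutedP]), but
    usable as a rewriting rule and easy to transport through filters. *)
Definition permuted {n : nat} {T : Type} (s : 'S_n) (X Y : set (n.-tuple T)) :=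
  forall t, Y (permute s t) <-> X t.

Section Permuted.
Context {n : nat} {T : Type}.
Implicit Types (s : 'S_n) (X Y : set (n.-tuple T)).

Lemma permuted_sym s X Y : permuted s X Y -> permuted (s^-1)%g Y X.
Proof. by move=> XY t; rewrite -XY permuteKV. Qed.

Lemma permutedP s X Y : permuted s X Y <-> set_bij X Y (permute s).
Proof.
split=> [XY|[XY _ YX] t].
  split=> [t /XY //|t u _ _ /(can_inj (permuteK s))//|t Yt].
  by exists (permute (s^-1)%g t); [apply/XY|]; rewrite permuteKV.
by split=> [/YX[u Xu /(can_inj (permuteK s))<-]|/XY].
Qed.

Lemma permuted_eq0 s X Y : permuted s X Y -> X = set0 <-> Y = set0.
Proof.
move=> XY; split=> E0; apply/seteqP; split=> // t.
  by rewrite -(permuteKV s t) => /XY; rewrite E0.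
by move=> /XY; rewrite E0.
Qed.

End Permuted.

Section PermutedFilter.
Context {R : realType} {n : nat}.
Implicit Types (s : 'S_n) (X Y : set (n.-tuple (R * R))) (a b : R).

Lemma dom_filterP a b X T : dom_filter a b X T <->
  within_domain a b X T /\
  forall k : 'I_n, (exists2 U, within_domain a b X U & (tnth U k).1 = a) /\
                   (exists2 U, within_domain a b X U & (tnth U k).2 = b).
Proof. by rewrite /dom_filter; case: asboolP => H; split=> // -[]. Qed.

Lemma permuted_within_domain s a b X Y :
  permuted s X Y -> permuted s (within_domain a b X) (within_domain a b Y).
Proof.
move=> XY T; rewrite /within_domain /= XY.
split=> -[XT inT]; split=> // k; first by have := inT (s k); rewrite tnth_permute.
by rewrite tnth_permuteV.
Qed.

(** The requirement that every position attains both ends of the domain is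
    quantified over all positions, hence insensitive to their order. *)
Lemma permuted_dom_filter s a b X Y :
  permuted s X Y -> permuted s (dom_filter a b X) (dom_filter a b Y).
Proof.
have half s' X' Y' T : permuted s' X' Y' ->
    dom_filter a b X' T -> dom_filter a b Y' (permute s' T).
  move=> XY /dom_filterP[XT ends]; have XY' := permuted_within_domain s' a b X' Y' XY.
  apply/dom_filterP; split=> [|k]; first exact/XY'.
  have [[U XU Ua] [V XV Vb]] := ends ((s'^-1)%g k).
  by split; [exists (permute s' U)|exists (permute s' V)];
    rewrite ?XY' // tnth_permuteV.
move=> XY T; split; last exact: half.
by move/(half (s^-1)%g _ _ _ (permuted_sym _ _ _ XY)); rewrite permuteK.
Qed.

End PermutedFilter.

(** * Results and projections *)

Section Projection.
Context {R : realType} {n : nat} {S : setting R n}.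
Implicit Types (op : complete_op R) (sigma tau : n.-tuple 'I_n)
  (T : n.-tuple (R * R)) (K : set (oie R (label S))).

Local Notation void := (oie_void R (label S)).

Lemma resultE op sigma : result S op sigma <> void ->
  result S op sigma =
    OIE [seq inst S i | i <- sigma] [set tval T | T in op_filter op (feas S sigma)]
      (@bound R @` [set tval T | T in op_filter op (feas S sigma)])
      (\bigcup_k atoms (inst S (tnth sigma k))).
Proof.
by rewrite /result; case: asboolP.
Qed.

Lemma formations_result op sigma T : result S op sigma <> void ->
  formations (result S op sigma) (tval T) <-> op_filter op (feas S sigma) T.
Proof.
move=> /resultE->; split=> [[U FU /val_inj<-]//|FT]; by exists T.
Qed.

Lemma perm_end_times s T : end_times (permute s T) = end_times T.
Proof.
apply/perm_sort_leP/perm_undup/perm_mem.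
by apply: perm_map; apply: perm_eq_permute.
Qed.

Lemma end_group_permute s sigma T t :
  end_group (S := S) (permute s sigma) (permute s T) t = end_group sigma T t.
Proof.
rewrite /end_group; apply/seteqP; split=> _ [k /= Tk <-].
  by exists ((s^-1)%g k); rewrite -tnth_permuteV.
by exists (s k) => /=; rewrite tnth_permute.
Qed.

(** Only the set of ending times and the operands attached to each of them
    enter the definition. *)
Lemma generated_permute s sigma T :
  generated (S := S) (permute s sigma) (permute s T) = generated sigma T.
Proof.
rewrite /generated perm_end_times.
have -> // : end_group (S := S) (permute s sigma) (permute s T) =
             end_group sigma T.
by apply: funext => t; apply: end_group_permute.
Qed.

(** The equivalence provides a permutation of the components; as [inst] is
    injective, it already permutes the index tuples, and the same permutation
    matches the formations, so [generated_permute] applies. *)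
Lemma perm_equiv_projection op sigma tau :
  result S op sigma <> void ->
  perm_equiv (result S op sigma) (result S op tau) ->
  projection S op sigma = projection S op tau.
Proof.
move=> Ns [[/Ns //]|[_ [Nt]]].
move=> [m [s [c [c' [X [X' [[Ec Ec'] [[EF EF'] [Es [XX' _]]]]]]]]]].
have Rs := resultE op sigma Ns; have Rt := resultE op tau Nt.
(* Both results have n components, which determines the size of the matrix. *)
have mn : m = n.
  by rewrite -(size_tuple c) -Ec Rs /= size_map size_tuple.
subst m; move/permutedP: XX' => XX'.
have Etau : permute s sigma = tau.
  have Ecs : c = map_tuple (inst S) sigma by apply: val_inj; rewrite /= -Ec Rs.
  have Ect : c' = map_tuple (inst S) tau by apply: val_inj; rewrite /= -Ec' Rt.
  apply: val_inj; apply: (inj_map (@inst_inj _ _ S)).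
  by move/(congr1 val): Es; rewrite Ecs Ect permute_map.
have FX T : formations (result S op sigma) (tval T) <-> X T.
  by rewrite EF; split=> [[U XU /val_inj<-]//|XT]; exists T.
have FX' T : formations (result S op tau) (tval T) <-> X' T.
  by rewrite EF'; split=> [[U XU /val_inj<-]//|XT]; exists T.
rewrite -Etau; apply/seteqP; split=> e [T] /=.
  move=> /FX/XX' XT gen; exists (permute s T); first by rewrite Etau; apply/FX'.
  by rewrite generated_permute.
rewrite Etau -(permuteKV s T) => /FX'/XX' XT.
rewrite -Etau generated_permute => gen.
by exists (permute (s^-1)%g T) => //; apply/FX.
Qed.

Lemma permuted_assignments s sigma :
  permuted s (assignments (inst S) sigma)
             (assignments (inst S) (permute s sigma)).
Proof.
move=> T; split=> asgT k; first by have := asgT (s k); rewrite !tnth_permute.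
by rewrite !tnth_permuteV.
Qed.

Lemma permuted_feas s sigma : index_tuple sigma ->
  permuted s (feas S sigma) (feas S (permute s sigma)).
Proof.
move=> Hs T; rewrite /feas /setD /= permuted_assignments.
have /permutedP inf := infeas_permute S Hs
  (index_tuple_permute s sigma Hs) erefl.
by split=> -[asgT infT]; split=> // /inf.
Qed.

(** Each clause that makes a result void, and each component of a non-void one,
    is invariant under permuting positions; the filter is the only ingredient
    that may depend on their order, whence the hypothesis. *)
Lemma perm_equiv_result op s sigma : index_tuple sigma ->
  permuted s (op_filter op (feas S sigma))
             (op_filter op (feas S (permute s sigma))) ->
  perm_equiv (result S op sigma) (result S op (permute s sigma)).
Proof.
move=> Hs FF'; set tau := permute s sigma in FF' *.
have ff' : permuted s (feas S sigma) (feas S tau) by apply: permuted_feas.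
have Ecap : \bigcap_k atoms (inst S (tnth sigma k)) =
            \bigcap_k atoms (inst S (tnth tau k)).
  apply/seteqP; split=> l al k _; last first.
    by have := al (s k) I; rewrite tnth_permute.
  by rewrite tnth_permuteV; apply: al.
have Ecup : \bigcup_k atoms (inst S (tnth sigma k)) =
            \bigcup_k atoms (inst S (tnth tau k)).
  apply/seteqP; split=> l [k _ al].
    by exists (s k); rewrite ?tnth_permute.
  by exists ((s^-1)%g k); rewrite // -tnth_permuteV.
have Evoid : (exists k, inst S (tnth sigma k) = void) <->
             (exists k, inst S (tnth tau k) = void).
  split=> -[k kv]; first by exists (s k); rewrite tnth_permute.
  by exists ((s^-1)%g k); rewrite -tnth_permuteV.
have Ebound : @bound R @` [set tval T | T in op_filter op (feas S sigma)] =
              @bound R @` [set tval T | T in op_filter op (feas S tau)].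
  apply/seteqP; split=> _ [_ [T FT <-] <-].
    exists (permute s T); first by exists (permute s T) => //; apply/FF'.
    exact/perm_bound/perm_eq_permute.
  rewrite -(permuteKV s T) in FT *; move/FF' in FT.
  exists (permute (s^-1)%g T); first by eexists; first exact: FT.
  by apply: perm_bound; rewrite perm_sym; apply: perm_eq_permute.
rewrite /result Ecap (propext Evoid) (propext (permuted_eq0 _ _ _ ff')).
rewrite (propext (permuted_eq0 _ _ _ FF')).
case: asboolP => [_|N]; first by left.
have OIE_nonvoid (C : seq (oie R (label S))) (F : set (n.-tuple (R * R))) J A :
    F <> set0 -> OIE C [set tval T | T in F] J A <> void.
  by move=> F0 [_ FE _ _]; apply: F0; apply: image_set0_set0 FE.
have Ft0 : op_filter op (feas S tau) <> set0 by move=> F0; apply: N; do 3!right.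
right; split; first by apply: OIE_nonvoid => /(permuted_eq0 _ _ _ FF').
split; first exact: OIE_nonvoid.
exists n, s, (map_tuple (inst S) sigma), (map_tuple (inst S) tau).
exists (op_filter op (feas S sigma)), (op_filter op (feas S tau)).
by rewrite permute_map; do 4!split => //; first exact/permutedP.
Qed.

Lemma perm_equiv_result_refl op sigma : index_tuple sigma ->
  perm_equiv (result S op sigma) (result S op sigma).
Proof.
move=> Hs; have permute1 (T : Type) (t : n.-tuple T) : permute 1%g t = t.
  by apply: eq_from_tnth => k; rewrite tnth_mktuple invg1 perm1.
have := perm_equiv_result op 1%g sigma Hs; rewrite permute1; apply.
by move=> T; rewrite permute1.
Qed.

Lemma perm_equiv_addition a b sigma tau : index_tuple sigma -> index_tuple tau ->
  perm_equiv (result S (CSA a b) sigma) (result S (CSA a b) tau).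
Proof.
move=> Hs Ht; have [s <-] := index_tuples_permute sigma tau Hs Ht.
by apply: perm_equiv_result => //; apply: permuted_dom_filter; apply: permuted_feas.
Qed.

(** Every position ends at some time, so every operand occurs; having n entries,
    the expression then has room for no repetition. *)
Lemma generated_perm_eq sigma T e : index_tuple sigma ->
  generated (S := S) sigma T e -> perm_eq (operands e) (map_tuple (opd S) sigma).
Proof.
move=> Hs [bs [sz_bs ord_bs Ee]].
have sub : {subset map_tuple (opd S) sigma <= operands e}.
  move=> _ /tnthP[k ->]; rewrite tnth_map.
  change (opd S (tnth sigma k) \in tval (operands e)); rewrite Ee.
  have : (tnth T k).2 \in end_times T.
    by rewrite mem_sort mem_undup; apply/map_f/mem_tnth.
  move=> /(nthP 0)[theta lt_theta Etheta]; apply/flattenP.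
  exists (nth [::] bs theta); first by rewrite mem_nth // sz_bs.
  have [_] := ord_bs theta lt_theta; rewrite Etheta => E.
  suff : [set` nth [::] bs theta] (opd S (tnth sigma k)) by [].
  by rewrite E; exists k.
have uniq_p : uniq (map_tuple (opd S) sigma).
  by rewrite map_inj_uniq ?index_tuple_uniq //; apply: operand_inj.
have [|_ Em] := uniq_min_size uniq_p sub; first by rewrite !size_tuple.
rewrite perm_sym; apply: uniq_perm => //.
by rewrite -(eq_uniq _ Em) // !size_tuple.
Qed.

Lemma generated_value {X : Type} (odot : n.-tuple X -> X) (v : operand S -> X)
    sigma T e : perm_invariant odot -> index_tuple sigma ->
  generated (S := S) sigma T e -> value odot v e = value odot v (expr_of S sigma).
Proof.
move=> odot_inv Hs /(generated_perm_eq _ _ _ Hs)/perm_eq_permuteP[s Es].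
by rewrite /value /= -Es -permute_map odot_inv.
Qed.

Lemma feas_lt sigma T k : feas S sigma T -> (tnth T k).1 < (tnth T k).2.
Proof. by move=> [/(_ k) asgT _]; apply: is_oie_lt asgT; apply: inst_oie. Qed.

(** Along an ascending tuple each interval starts after all earlier ones have
    ended, and intervals are not degenerate: the ending times increase
    strictly, so every group is a singleton. *)
Lemma generated_ascending sigma T :
  asc_filter (feas S sigma) T ->
  generated (S := S) sigma T = [set expr_of S sigma].
Proof.
move=> [fT ascT].
have lt_end (p q : 'I_n) : (p < q)%N -> (tnth T p).2 < (tnth T q).2.
  by move=> pq; apply: le_lt_trans (ascT p q pq) (feas_lt _ _ _ fT).
have inj_end (p q : 'I_n) : (tnth T p).2 = (tnth T q).2 -> p = q.
  move=> E; apply: val_inj => /=.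
  by case: (ltngtP p q) => // /lt_end; rewrite E ltxx.
have Eends : end_times T = [seq (tnth T k).2 | k <- enum 'I_n].
  have E : [seq t.2 | t <- T] = [seq (tnth T k).2 | k <- enum 'I_n].
    by rewrite -[in LHS](map_tnth_enum T) -map_comp.
  have sorted_ends : sorted <%R [seq (tnth T k).2 | k <- enum 'I_n].
    rewrite sorted_map; apply: (@sub_sorted _ (relpre val ltn)) => //.
    by rewrite -sorted_map val_enum_ord iota_ltn_sorted.
  have /andP[uniq_ends le_ends] := lt_sorted_is_uniq_le sorted_ends.
  by rewrite /end_times E undup_id // sort_le_id.
have sz_ends : size (end_times T) = n by rewrite Eends size_map size_enum_ord.
have nth_ends (k : 'I_n) : nth 0 (end_times T) k = (tnth T k).2.
  by rewrite Eends (nth_map k) ?size_enum_ord // nth_ord_enum.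
have group1 k : end_group (S := S) sigma T (tnth T k).2 = [set opd S (tnth sigma k)].
  by apply/seteqP; split=> [_ [j /= /inj_end -> <-]|_ ->] //; exists k.
apply/seteqP; split=> [[e] [bs [sz_bs ord_bs /= Ee]]|_ ->].
  congr OpExpr; apply: val_inj; rewrite /= Ee -[RHS]flatten_seq1; congr flatten.
  apply: (@eq_from_nth _ [::]) => [|i]; rewrite ?size_map sz_bs sz_ends ?size_tuple //.
  move=> lt_in; have := ord_bs i; rewrite sz_ends => /(_ lt_in).
  rewrite (nth_ends (Ordinal lt_in)) group1 => -[uniq_b Eb].
  have op0 := opd S (Ordinal lt_in).
  rewrite (nth_map op0) ?size_map ?size_tuple //.
  rewrite (nth_map (Ordinal lt_in)) ?size_tuple //.
  rewrite -[nth (Ordinal lt_in) _ _](tnth_nth _ _ (Ordinal lt_in)).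
  apply/perm_small_eq => //; apply: uniq_perm => // p; rewrite inE.
  have Ep : (p \in nth [::] bs i : Prop) = (p = _) := congr1 (fun A => A p) Eb.
  by apply/idP/eqP; rewrite Ep.
exists [seq [:: p] | p <- map_tuple (opd S) sigma].
split=> [|theta|]; first by rewrite sz_ends size_map size_tuple.
  rewrite sz_ends => lt_n; rewrite (nth_ends (Ordinal lt_n)) group1.
  rewrite (nth_map (opd S (Ordinal lt_n))) ?size_tuple //.
  rewrite -[nth _ _ _](tnth_nth _ _ (Ordinal lt_n)) tnth_map.
  by split=> //; apply/seteqP; split=> p /=; rewrite inE => /eqP.
by rewrite flatten_seq1.
Qed.

Lemma projection_multiplication sigma : result S CSM sigma <> void ->
  projection S CSM sigma = [set expr_of S sigma].
Proof.
move=> Ns; have [T FT] : exists T, asc_filter (feas S sigma) T.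
  apply: contrapT => noT; apply: Ns; rewrite /result; case: asboolP => // N.
  exfalso; apply: N; do 3!right; apply/seteqP; split=> // T FT.
  by apply: noT; exists T.
apply/seteqP; split=> [e [U /(formations_result CSM) FU]|_ ->].
  by rewrite generated_ascending //; apply: FU.
by exists T; [apply/(formations_result CSM)|rewrite generated_ascending].
Qed.

(** With a single ending time there is a single group, and its ordering is
    free. *)
Lemma generated_simultaneous sigma T t e : (0 < n)%N ->
  (forall k, (tnth T k).2 = t) -> index_tuple sigma ->
  perm_eq (operands e) (map_tuple (opd S) sigma) -> generated (S := S) sigma T e.
Proof.
move=> n_gt0 endT Hs Ee.
have Eends : end_times T = [:: t].
  have E : [seq u.2 | u <- T] =i [:: t].
    move=> x; rewrite inE; apply/mapP/eqP => [[u /tnthP[k ->] ->] //|->].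
    by exists (tnth T (Ordinal n_gt0)); rewrite ?mem_tnth.
  by rewrite /end_times (perm_small_eq _ (perm_undup E)).
exists [:: tval (operands e)]; rewrite Eends; split=> //=; last by rewrite cats0.
case=> // _; split=> /=.
  rewrite (perm_uniq Ee) map_inj_uniq ?index_tuple_uniq //.
  exact: operand_inj.
apply/seteqP; split=> p /=; rewrite (perm_mem Ee).
  by move=> /tnthP[k ->]; exists k; rewrite ?tnth_map //=.
by move=> [k _ <-]; rewrite -(tnth_map (opd S)) mem_tnth.
Qed.

Definition result_class op sigma : set (oie R (label S)) :=
  [set r | results S op r /\ perm_equiv (result S op sigma) r].

Lemma result_class_refl op sigma : index_tuple sigma ->
  result_class op sigma (result S op sigma).
Proof.
by move=> Hs; split; [exists sigma|apply: perm_equiv_result_refl].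
Qed.

Lemma orbit_result_class op sigma : index_tuple sigma ->
  orbit_space S op (result_class op sigma).
Proof. by move=> Hs; exists (result S op sigma) => //; exists sigma. Qed.

Lemma nonvoid_result_class op sigma : index_tuple sigma ->
  result S op sigma <> void -> nonvoid_class S op (result_class op sigma).
Proof.
move=> Hs Ns; split=> [|r [_ [[/Ns //]|[_ []]] //]].
exact: orbit_result_class.
Qed.

(** The class of the void result consists of the void instance, so every
    representative of a class of non-void results is non-void. *)
Lemma nonvoid_classP op K : nonvoid_class S op K ->
  exists sigma, [/\ index_tuple sigma, result S op sigma <> void &
                    K = result_class op sigma].
Proof.
move=> [[_ [sigma Hs ->] EK] Nv]; exists sigma; split=> //.
by apply: Nv; rewrite EK; apply: result_class_refl.
Qed.

Lemma is_Op_result_class op sigma : result S op sigma <> void ->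
  is_Op S op (result_class op sigma) (projection S op sigma).
Proof.
by move=> Ns tau _ [_ eqv]; rewrite (perm_equiv_projection _ _ _ Ns eqv).
Qed.

Lemma is_Op_inj op sigma Op : index_tuple sigma ->
  is_Op S op (result_class op sigma) Op -> projection S op sigma = Op.
Proof. by move=> Hs; apply => //; apply: result_class_refl. Qed.

End Projection.

(** * Settings of single intervals *)

Section SingleIntervals.
Context {R : realType} {n : nat} (J : 'I_n -> R * R)
  (J_lt : forall i, (J i).1 < (J i).2).

(** The label i is the only atomic event of the i-th instance: this makes the
    instances distinct and their sets of atoms disjoint, whatever J is. *)
Definition single_inst (i : 'I_n) : oie R 'I_n :=
  OIE [::] [set [:: J i]] (@bound R @` [set [:: J i]]) [set i].

Lemma single_inst_oie i : is_oie (single_inst i).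
Proof.
apply: is_oie_event => //; last by exists i.
  by move=> _ ->; split=> // t; rewrite inE => /eqP->.
by exists [:: J i].
Qed.

Lemma single_inst_inj : injective single_inst.
Proof. by move=> i j [_ _ Eij]; have : [set i] i by []; rewrite Eij. Qed.

Lemma no_infeas_sub (sigma : n.-tuple 'I_n) :
  index_tuple sigma -> set0 `<=` assignments single_inst sigma.
Proof. by move=> _ T. Qed.

Lemma no_infeas_permute (sigma tau : n.-tuple 'I_n) (s : 'S_n) :
  index_tuple sigma -> index_tuple tau -> permute s sigma = tau ->
  set_bij set0 set0 (@permute n (R * R) s).
Proof. by move=> *; apply/permutedP. Qed.

Definition single_setting : setting R n :=
  Setting single_inst_oie single_inst_inj no_infeas_sub no_infeas_permute
    (event_of := id) (operand_of := id) (@inj_id 'I_n).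

Lemma feas_single sigma :
  feas single_setting sigma = [set map_tuple J sigma].
Proof.
rewrite /feas setD0; apply/seteqP; split=> T /=.
  move=> asgT; apply: eq_from_tnth => k; rewrite tnth_map.
  by have [_ /= -> <-] := asgT k; rewrite /bound !big_nil -surjective_pairing.
move=> -> k; rewrite tnth_map; exists [:: J (tnth sigma k)] => //.
by rewrite /bound !big_nil -surjective_pairing.
Qed.

Lemma result_single_nonvoid op sigma : (1 < n)%N -> index_tuple sigma ->
  op_filter op [set map_tuple J sigma] (map_tuple J sigma) ->
  result single_setting op sigma <> oie_void R 'I_n.
Proof.
move=> n_gt1 Hs Fs; rewrite /result feas_single; case: asboolP; last first.
  move=> _ /(congr1 (@formations R 'I_n)) /= F0.
  suff : set0 (tval (map_tuple J sigma)) by [].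
  by rewrite -F0; exists (map_tuple J sigma).
case=> [[i all_i]|]; last first.
  case=> [[k /(congr1 (@formations R 'I_n)) /= E]|[E|E]].
  - by suff : set0 [:: J (tnth sigma k)] by []; rewrite -E.
  - by suff : set0 (map_tuple J sigma) by []; rewrite -E.
  - by suff : set0 (map_tuple J sigma) by []; rewrite -E.
have := all_i (Ordinal n_gt1) I; rewrite (all_i (Ordinal (ltnW n_gt1)) I) /=.
by move/(tuple_uniqP _ (index_tuple_uniq _ Hs)).
Qed.

End SingleIntervals.

Theorem corollary4 (R : realType) (n : nat) (hn : (1 < n)%N)
    (alpha beta : R) (hab : alpha < beta)
    (X : Type) (odot : n.-tuple X -> X) :
  (forall S : setting R n,
     (* existence and uniqueness of Op_K for both operations *)
     (forall op : complete_op R, op = CSA alpha beta \/ op = CSM ->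
        forall K, nonvoid_class S op K -> exists! Op, is_Op S op K Op) /\
     (* (1), addition: single class, one set Op for the whole orbit *)
     (exists K, orbit_space S (CSA alpha beta) = [set K]) /\
     ((forall sigma, index_tuple sigma ->
         result S (CSA alpha beta) sigma <> oie_void R (label S)) ->
      exists! Op, forall sigma, index_tuple sigma ->
        projection S (CSA alpha beta) sigma = Op) /\
     (perm_invariant odot ->
      forall K Op, nonvoid_class S (CSA alpha beta) K ->
        is_Op S (CSA alpha beta) K Op ->
        forall (v : operand S -> X) e1 e2, Op e1 -> Op e2 ->
          value odot v e1 = value odot v e2) /\
     (* (2), multiplication: Op_K is a singleton *)
     (forall K Op, nonvoid_class S CSM K -> is_Op S CSM K Op ->
        exists e, Op = [set e] /\
          forall sigma, index_tuple sigma -> K (result S CSM sigma) ->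
            e = expr_of S sigma)) /\
  (* (1), operators that are not permutation invariant *)
  (~ perm_invariant odot ->
   exists (S : setting R n) K Op (v : operand S -> X) e1 e2,
     nonvoid_class S (CSA alpha beta) K /\ is_Op S (CSA alpha beta) K Op /\
     Op e1 /\ Op e2 /\ value odot v e1 <> value odot v e2) /\
  (* (2), several classes *)
  (exists (S : setting R n) K1 K2,
     orbit_space S CSM K1 /\ orbit_space S CSM K2 /\ K1 <> K2).
Proof.
have n_gt0 : (0 < n)%N by apply: ltnW.
have Hid := index_tuple_ord_tuple n.
split; [move=> S|split].
- split.
    move=> op _ K /nonvoid_classP[sigma [Hs Ns ->]].
    exists (projection S op sigma); split=> [|Op]; first exact: is_Op_result_class.
    exact: is_Op_inj.
  split.
    exists (result_class (CSA alpha beta) (ord_tuple n)).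
    apply/seteqP; split=> K /=; last by move=> ->; apply: orbit_result_class.
    move=> [_ [sigma Hs ->] ->].
    apply/seteqP; split=> r [[tau Ht ->] _]; split; try by exists tau.
      exact: perm_equiv_addition.
    exact: perm_equiv_addition.
  split.
    move=> Nv; exists (projection S (CSA alpha beta) (ord_tuple n)).
    split=> [sigma Hs|Op]; last exact.
    by apply: perm_equiv_projection; [apply: Nv|apply: perm_equiv_addition].
  split.
    move=> odot_inv K Op /nonvoid_classP[sigma [Hs _ ->]].
    move=> /(is_Op_inj _ _ _ Hs) <- v e1 e2 [T1 _ gen1] [T2 _ gen2].
    rewrite (generated_value _ _ _ _ _ odot_inv Hs gen1).
    by rewrite (generated_value _ _ _ _ _ odot_inv Hs gen2).
  move=> K Op /nonvoid_classP[sigma [Hs Ns EK]] OpK; exists (expr_of S sigma).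
  split=> [|tau Ht Ktau].
    rewrite -(projection_multiplication _ Ns); apply/esym/is_Op_inj => //.
    by rewrite -EK.
  have Nt : result S CSM tau <> oie_void R (label S).
    by move: Ktau; rewrite EK => -[_ [[/Ns //]|[_ []]]].
  have : [set expr_of S sigma] = [set expr_of S tau].
    rewrite -(projection_multiplication _ Ns) -(projection_multiplication _ Nt).
    rewrite (OpK tau) // OpK //; rewrite EK; exact: result_class_refl.
  by move=> E; have : [set expr_of S sigma] (expr_of S sigma) by []; rewrite E.
- move=> /existsNP[s /existsNP[x odot_x]].
  pose J (i : 'I_n) := (alpha, beta).
  pose S := single_setting J (fun=> hab).
  have Fid : dom_filter alpha beta [set map_tuple J (ord_tuple n)]
               (map_tuple J (ord_tuple n)).
    have Wid : within_domain alpha beta [set map_tuple J (ord_tuple n)]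
                 (map_tuple J (ord_tuple n)).
      by split=> // k; rewrite tnth_map /= !lexx.
    by apply/dom_filterP; split=> // k; split;
      exists (map_tuple J (ord_tuple n)); rewrite ?tnth_map.
  have Nid : result S (CSA alpha beta) (ord_tuple n) <> oie_void R (label S).
    exact: result_single_nonvoid.
  have Op_e (e : op_expr n 'I_n) : perm_eq (operands e) (ord_tuple n) ->
      projection S (CSA alpha beta) (ord_tuple n) e.
    move=> Ee; exists (map_tuple J (ord_tuple n)).
      by apply/formations_result => //=; rewrite feas_single.
    apply: (@generated_simultaneous _ _ S _ _ beta) => //.
      by move=> k; rewrite tnth_map.
    by rewrite /= map_id.
  exists S, (result_class (CSA alpha beta) (ord_tuple n)).
  exists (projection S (CSA alpha beta) (ord_tuple n)), (tnth x).
  exists (OpExpr (permute s (ord_tuple n))), (OpExpr (ord_tuple n)).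
  split; first exact: nonvoid_result_class.
  split; first exact: is_Op_result_class.
  split; first by apply: Op_e; apply: perm_eq_permute.
  split; first exact: Op_e.
  rewrite /value /= -permute_map.
  (* The operand i is interpreted as x_i, so the two values are those of odot
     at the permuted and at the original x. *)
  have -> // : map_tuple (tnth x) (ord_tuple n) = x.
  by apply: eq_from_tnth => k; rewrite tnth_map tnth_ord_tuple.
- pose J (i : 'I_n) : R * R := (i%:R, i.+1%:R).
  have J_lt i : (J i).1 < (J i).2 by rewrite ltr_nat.
  pose S := single_setting J J_lt.
  pose i0 := Ordinal n_gt0; pose i1 := Ordinal hn.
  pose tau := permute (tperm i0 i1) (ord_tuple n).
  have Htau : index_tuple tau by apply: index_tuple_permute.
  have tau0 : tnth tau i0 = i1.
    by rewrite tnth_permuteV tpermV tpermL tnth_ord_tuple.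
  have tau1 : tnth tau i1 = i0.
    by rewrite tnth_permuteV tpermV tpermR tnth_ord_tuple.
  have Nid : result S CSM (ord_tuple n) <> oie_void R (label S).
    apply: result_single_nonvoid => //; split=> // p q pq.
    by rewrite !tnth_map !tnth_ord_tuple ler_nat.
  have Vtau : result S CSM tau = oie_void R (label S).
    rewrite /result; case: asboolP => // N; exfalso; apply: N; do 3!right.
    apply/seteqP; split=> // T []; rewrite feas_single => -> /(_ i0 i1 isT).
    by rewrite (tnth_map J tau i0) (tnth_map J tau i1) tau0 tau1 ler_nat.
  exists S, (result_class CSM (ord_tuple n)), (result_class CSM tau).
  split; first exact: orbit_result_class.
  split; first exact: orbit_result_class.
  move=> E; have [_ Nv] := nonvoid_result_class CSM _ Hid Nid.
  apply: (Nv (result S CSM tau)) => //; rewrite E; exact: result_class_refl.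
Qed.
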